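(* Let $X$ be a connected, locally connected, Hausdorff, first countable, normal topological space, $V$ a finite dimensional Euclidean vector space, and $f:X\to V$ a continuous closed map that has local convexity data and is locally fiber connected. Then: (i) all fibers of $f$ are connected; (ii) $f$ is open onto its image; (iii) the image $f(X)$ is a closed convex subset of $V$.
   Context: A subset $C\subset V$ is a cone with vertex $v_0$ if $v_0\in C$ and $(1-\lambda)v_0+\lambda v\in C$ for every $\lambda\ge 0$ and every $v\in C$, $v\ne v_0$; it is a convex cone if it is moreover convex. A continuous map $f:X\to V$ has local convexity data if for each $x\in X$ and every sufficiently small open neighborhood $U_x$ of $x$ there is a convex cone $C_x\subset V$ with vertex $f(x)$, endowed with the subspace topology from $V$, such that (VN) $f(U_x)\subset C_x$ and $f(U_x)$ is a neighborhood of $f(x)$ in $C_x$; and (SLO) $f|_{U_x}:U_x\to C_x$ is an open map, and for every neighborhood $U'_x\subset U_x$ of $x$ the set $f(U'_x)$ is a neighborhood of $f(x)$ in $C_x$. A subset $A\subset X$ satisfies condition (LFC) if for every $a\in A$, the set $A$ does not intersect two different connected components of the fiber $f^{-1}(f(a))$. The map $f$ is locally fiber connected if for every $x\in X$, every open neighborhood of $x$ contains a neighborhood $U_x$ of $x$ satisfying (LFC). ''Open onto its image'' means $f:X\to f(X)$ is open for the subspace topology on $f(X)$. *)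

(* Defs.v *)
From HB Require Import structures.
From mathcomp Require Import all_boot all_order all_algebra.
From mathcomp Require Import all_classical all_reals all_analysis.
Set Implicit Arguments. Unset Strict Implicit. Unset Printing Implicit Defensive.
Import Order.TTheory GRing.Theory Num.Theory.
Import numFieldNormedType.Exports.
Local Open Scope classical_set_scope.
Local Open Scope ring_scope.

Section defs.
Context {R : realType} {n : nat} {X : topologicalType}.
Notation V := 'rV[R]_n.

Definition rel_open (C A : set V) : Prop :=
  exists O : set V, open O /\ A = C `&` O.

Definition rel_nbhs (C : set V) (p : V) (N : set V) : Prop :=
  exists O : set V, [/\ open O, O p & C `&` O `<=` N].

Definition cone_with_vertex (C : set V) (v0 : V) : Prop :=
  C v0 /\ forall (lambda : R) (v : V), 0 <= lambda -> C v -> v <> v0 ->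
    C ((1 - lambda) *: v0 + lambda *: v).

Definition convex_subset (C : set V) : Prop :=
  forall (x y : V) (t : R), 0 <= t -> t <= 1 -> C x -> C y ->
    C ((1 - t) *: x + t *: y).

Definition convex_cone (C : set V) (v0 : V) : Prop :=
  cone_with_vertex C v0 /\ convex_subset C.

Definition local_convexity_data (f : X -> V) : Prop :=
  forall x : X, exists N : set X, nbhs x N /\
    forall U : set X, open U -> U x -> U `<=` N ->
      exists C : set V, [/\ convex_cone C (f x),
        f @` U `<=` C, rel_nbhs C (f x) (f @` U),
        (forall W : set X, open W -> W `<=` U -> rel_open C (f @` W)) &
        (forall U' : set X, nbhs x U' -> U' `<=` U -> rel_nbhs C (f x) (f @` U'))].

Definition LFC (f : X -> V) (A : set X) : Prop :=
  forall a : X, A a -> forall y z : X, A y -> A z -> f y = f a -> f z = f a ->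
    connected_component (f @^-1` [set f a]) y =
    connected_component (f @^-1` [set f a]) z.

Definition locally_fiber_connected (f : X -> V) : Prop :=
  forall x : X, forall O : set X, open O -> O x ->
    exists U : set X, [/\ nbhs x U, U `<=` O & LFC f U].

Definition closed_map (f : X -> V) : Prop :=
  forall A : set X, closed A -> closed (f @` A).

Definition open_onto_image (f : X -> V) : Prop :=
  forall W : set X, open W -> rel_open (range f) (f @` W).
End defs.

Section top.
Context {T : topologicalType}.
Definition first_countable : Prop :=
  forall x : T, exists B : nat -> set T,
    (forall k, nbhs x (B k)) /\ (forall N, nbhs x N -> exists k, B k `<=` N).
Definition locally_connected : Prop :=
  forall x : T, forall N : set T, nbhs x N ->
    exists U : set T, [/\ open U, U x, connected U & U `<=` N].
End top.
Arguments first_countable : clear implicits.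
Arguments locally_connected : clear implicits.

(* Main.v *)
Require Import Defs.
From HB Require Import structures.
From mathcomp Require Import all_boot all_order all_algebra.
From mathcomp Require Import ring lra.
From mathcomp Require Import all_classical all_reals all_analysis.
Import Order.TTheory GRing.Theory Num.Theory.
Import numFieldNormedType.Exports.
Local Open Scope classical_set_scope.
Local Open Scope ring_scope.

(** Mountain-pass argument. Let [g] be a convex continuous function with bounded
    sublevel sets; then every [{g \o f <= c}] is connected. Otherwise two points
    [a], [b] are separated by a clopen partition of some sublevel set, but not of
    a higher one since [X] is connected; let [S] be the supremum of the
    levels at which they are separated. As [f] is closed and [X] normal, a
    partition at level [S] extends to a slightly higher level, so [a] and [b] are
    not separated at level [S]. On the other hand [{g \o f < S}] splits into two
    open parts containing [a] and [b]. Near a point of level [S], the set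
    [{g \o f < S}] is mapped by [f] openly onto a convex set and with fibers not
    split by the partition, so only one of the parts is seen there; the partition
    thus extends to [{g \o f <= S}], a contradiction.

    With [g w = `|w - v|] and [c = 0], fibers are connected. With a convex [g]
    whose minimal set is a segment [[x, y]], the preimage of the segment is
    connected, whence convexity of the image. Openness follows because the cones
    are locally constant along a fiber, hence constant. *)

(** * Topology of connected sets and of sublevel sets of a real function *)

Lemma connected_sub_open (T : topologicalType) (K P Q : set T) :
  connected K -> open P -> open Q -> K `<=` P `|` Q ->
  K `&` P `&` Q = set0 -> K `&` P !=set0 -> K `<=` P.
Proof.
move=> cK oP oQ KPQ dPQ KP0.
rewrite -[X in X `<=` _](_ : K `&` P = K); first by move=> x [].
apply: cK => //; first by exists P.
exists (~` Q); first exact: open_closedC.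
apply/seteqP; split => [x [Kx Px]|x [Kx nQx]].
  by split=> // Qx; have : set0 x by rewrite -dPQ.
by split=> //; case: (KPQ _ Kx).
Qed.

Section sublevel.
Context {R : realType} {X : topologicalType}.
Variable h : X -> R.

(** Different quasi-components rather than components: two disjoint closed sets are what normality
    can enlarge. *)
Definition separated_in (c : R) (a b : X) : Prop :=
  exists A B : set X, [/\ closed A, closed B, A `&` B = set0,
    [set x | h x <= c] = A `|` B & A a /\ B b].

Lemma separated_in_le (c c' : R) (a b : X) : continuous h ->
  h a <= c -> h b <= c -> c <= c' ->
  separated_in c' a b -> separated_in c a b.
Proof.
move=> ch ha hb cc' [A [B [cA cB AB0 AB [Aa Bb]]]].
have cc : closed [set x | h x <= c].
  exact: (closed_comp (fun x _ => ch x) (@closed_le _ c)).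
exists (A `&` [set x | h x <= c]), (B `&` [set x | h x <= c]); split => //.
- exact: closedI.
- exact: closedI.
- by rewrite setIACA AB0 set0I.
- rewrite -setIUl -AB; apply/seteqP; split=> x /=; last by case.
  by move=> hx; split=> //; exact: le_trans cc'.
Qed.

(** A connected neighborhood inside a sublevel set cannot be cut by a partition at that level or a
    higher one, so separation from [a] does not change across it. Used for all levels from [c0] on,
    then for those in [[c0, S[]. *)
Lemma open_not_separated_in (I : set R) (a : X) : continuous h ->
  locally_connected X ->
  (forall c, I c -> h a <= c) ->
  let U := [set y | exists2 c, I c & h y < c] in
  let P := [set y | exists2 c, I c & h y < c /\ ~ separated_in c a y] in
  open P /\ open (U `\` P).
Proof.
move=> ch lX Ia U P.
have key y : U y -> exists N : set X, [/\ open N, N y, N `<=` U &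
    forall y' y'', N y' -> N y'' -> P y' -> P y''].
  move=> [c Ic hyc].
  have oc : open [set x | h x < c].
    exact: (open_comp (fun x _ => ch x) (@open_lt _ c)).
  have [N [oN Ny cN Nc]] := lX y _ (open_nbhs_nbhs (conj oc hyc)).
  exists N; split=> // [z /Nc hz|y' y'' Ny' Ny'' [c' Ic' [hy' nsep]]].
    by exists c.
  (* [m] is one of [c], [c'], hence in [I]; [N] lies below it, and a partition at level [m]
     restricts to level [c']. *)
  pose m := Num.max c c'.
  have Im : I m by rewrite /m /Num.max; case: ifP.
  exists m => //; split.
    by rewrite lt_max (Nc _ Ny'').
  move=> [A [B [cA cB AB0 AB [Aa By'']]]]; apply: nsep.
  apply: (@separated_in_le _ m) => //; [exact: Ia|exact: ltW|by rewrite le_max lexx orbT|].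
  exists A, B; split=> //; split=> //.
  have NAB : N `<=` ~` A `|` ~` B.
    move=> z Nz; apply: contrapT => /not_orP[/contrapT Az /contrapT Bz].
    by have : set0 z by rewrite -AB0.
  have NmAB : N `<=` A `|` B.
    by move=> z Nz; rewrite -AB /= le_max ltW ?(Nc _ Nz).
  have : N `<=` ~` A.
    apply: (@connected_sub_open _ _ _ (~` B)) => //; try exact: closed_openC.
    - apply/seteqP; split=> // z [[Nz nA] nB].
      by case: (NmAB _ Nz).
    - exists y''; split=> // Ay''.
      by have : set0 y'' by rewrite -AB0.
  by move=> /(_ _ Ny'); case: (NmAB _ Ny').
split; rewrite openE.
- move=> y Py; have Uy : U y by case: Py => c Ic []; exists c.
  have [N [oN Ny NU NP]] := key y Uy.
  rewrite /interior /= nbhsE; exists N; first by split.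
  by move=> z Nz; exact: NP Py.
- move=> y [Uy nPy]; have [N [oN Ny NU NP]] := key y Uy.
  rewrite /interior /= nbhsE; exists N; first by split.
  move=> z Nz; split; first exact: NU.
  by move=> Pz; apply: nPy; exact: NP Pz.
Qed.

(** The last two hypotheses carry the geometry: one lets a partition at a level spread to a higher
    level, the other lets a partition of [{h < S}] close up at level [S]. *)
Lemma sublevel_connected : continuous h ->
  connected [set: X] -> locally_connected X -> normal_space X ->
  (forall c (O : set X), open O -> [set x | h x <= c] `<=` O ->
     exists2 e, 0 < e & [set x | h x <= c + e] `<=` O) ->
  (forall y, exists W : set X, [/\ open W, W y,
     forall P Q : set X, open P -> open Q -> P `&` Q = set0 ->
       P `|` Q = [set x | h x < h y] -> W `&` P = set0 \/ W `&` Q = set0 &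
     forall z, W z -> h z = h y -> ~ closure [set x | h x < h y] z ->
       W `&` [set x | h x < h y] = set0]) ->
  forall c, connected [set x | h x <= c].
Proof.
move=> ch cX lX nX near_sub loc c0.
have closed_le_h c : closed [set x | h x <= c].
  exact: (closed_comp (fun x _ => ch x) (@closed_le _ c)).
suff noSep a b : ~ separated_in c0 a b.
  move=> B [b Bb] [G oG BG] [F cF BF].
  apply/seteqP; split=> [x|a ha]; first by rewrite BG => -[].
  apply: contrapT => nBa; apply: (noSep b a).
  exists B, ([set x | h x <= c0] `\` G); split.
  - by rewrite BF; exact: closedI.
  - by apply: closedI => //; exact: open_closedC.
  - by rewrite BG; apply/seteqP; split=> // x [[_ Gx] [_ nGx]].
  - rewrite BG; apply/seteqP; split=> x; last by case=> -[].
    by move=> hx; case: (pselect (G x)) => Gx; [left|right].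
  - by split=> //; split=> //; move: nBa; rewrite BG => nBa Ga; apply: nBa.
move=> sep0.
have [ha hb] : h a <= c0 /\ h b <= c0.
  case: sep0 => A [B [_ _ _ AB [Aa Bb]]]; split.
    by have /(_ _ (or_introl Aa)) : A `|` B `<=` [set x | h x <= c0] by rewrite AB.
  by have /(_ _ (or_intror Bb)) : A `|` B `<=` [set x | h x <= c0] by rewrite AB.
have sep_le c c' : c0 <= c -> c <= c' -> separated_in c' a b -> separated_in c a b.
  by move=> cc; apply: separated_in_le => //; [exact: le_trans ha cc|exact: le_trans hb cc].
have nsepaa c : ~ separated_in c a a.
  by move=> [A [B [_ _ AB0 _ [Aa Ba]]]]; have : set0 a by rewrite -AB0.
(* For levels from [c0] on, [P] and its complement are open and [a] is in [P], so [P] is all of [X]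
   and contains [b]. *)
have [c1 c01 nsep1] : exists2 c, c0 <= c & ~ separated_in c a b.
  pose U := [set y | exists2 c, c0 <= c & h y < c].
  pose P := [set y | exists2 c, c0 <= c & h y < c /\ ~ separated_in c a y].
  have [oP oQ] : open P /\ open (U `\` P).
    by apply: open_not_separated_in => // c /= cc; exact: le_trans ha _.
  have UT y : U y.
    exists (Num.max c0 (h y + 1)); rewrite /= ?le_max ?lexx // lt_max.
    by rewrite ltrDl ltr01 orbT.
  have : [set: X] `<=` P.
    apply: (@connected_sub_open _ _ _ (U `\` P)) => //.
    - by move=> y _; case: (pselect (P y)) => Py; [left|right; split].
    - by apply/seteqP; split=> // y [[_ Py] [_]].
    - exists a; split => //; exists (c0 + 1); rewrite /= ?lerDl //.
      by split=> //; apply: le_lt_trans ha _; rewrite ltrDl.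
  by move=> /(_ b I) [c /= cc [_ ns]]; exists c.
pose T := [set c | c0 <= c /\ separated_in c a b].
have T0 : T c0 by split.
have ubT : ubound T c1.
  move=> c [cc sc]; rewrite leNgt; apply/negP => c1c; apply: nsep1.
  by apply: sep_le sc => //; exact: ltW.
have supT : has_sup T by split; [exists c0|exists c1].
pose S := sup T.
have c0S : c0 <= S by apply: ub_le_sup => //; exists c1.
have sep_lt c : c0 <= c -> c < S -> separated_in c a b.
  move=> cc cS; have [|t [ct st] lt_t] := @sup_adherent _ T (S - c) _ supT.
    by rewrite subr_gt0.
  apply: sep_le st => //; apply/ltW; move: lt_t.
  by rewrite opprB addrCA subrr addr0.
case: (pselect (separated_in S a b)) => [|nsepS].
  move=> [A [B [cA cB AB0 AB [Aa Bb]]]].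
  have [G1 [G2 [oG1 oG2 AG1 BG2 G12]]] := (@normal_openP R X).1 nX A B cA cB AB0.
  have [|e e0 sube] := near_sub S (G1 `|` G2) (openU oG1 oG2).
    by rewrite AB; exact: setUSS.
  have : T (S + e).
    split; first by rewrite (le_trans c0S) // lerDl ltW.
    exists ([set x | h x <= S + e] `\` G2), ([set x | h x <= S + e] `\` G1); split.
    - by apply: closedI => //; exact: open_closedC.
    - by apply: closedI => //; exact: open_closedC.
    - apply/seteqP; split=> // x [[hx n2] [_ n1]].
      by case: (sube _ hx).
    - apply/seteqP; split=> [x hx|x]; last by case=> -[].
      case: (pselect (G1 x)) => G1x; last by right.
      by left; split=> // G2x; have : set0 x by rewrite -G12.
    - split; split.
      + by rewrite /= (le_trans ha) // (le_trans c0S) // lerDl ltW.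
      + by move=> G2a; have : (G1 `&` G2) a := conj (AG1 _ Aa) G2a; rewrite G12.
      + by rewrite /= (le_trans hb) // (le_trans c0S) // lerDl ltW.
      + by move=> G1b; have : (G1 `&` G2) b := conj G1b (BG2 _ Bb); rewrite G12.
  move=> /(ub_le_sup (ex_intro _ c1 ubT)); rewrite -/S.
  by rewrite leNgt ltrDl e0.
have c0ltS : c0 < S.
  rewrite lt_neqAle c0S andbT; apply/eqP => SE; apply: nsepS; rewrite -SE //.
(* [U] is [{h < S}]; [P] collects the points not separated from [a] at some level below [S], and [b]
   falls outside [P]. *)
pose U := [set y | exists2 c, c0 <= c < S & h y < c].
pose P := [set y | exists2 c, c0 <= c < S & h y < c /\ ~ separated_in c a y].
have [oP oQ] : open P /\ open (U `\` P).
  by apply: open_not_separated_in => // c /= /andP[cc _]; exact: le_trans ha _.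
have UE : U = [set x | h x < S].
  apply/seteqP; split=> y /=.
    by move=> [c /= /andP[_ cS] hc]; exact: lt_trans cS.
  move=> hS; pose m := Num.max c0 (h y).
  have mS : m < S by rewrite gt_max c0ltS.
  have [ml mr] := midf_lt mS.
  exists ((m + S) / 2) => /=.
    by rewrite mr andbT (le_trans _ (ltW ml)) // le_max lexx.
  by rewrite (le_lt_trans _ ml) // le_max lexx orbT.
pose Q := U `\` P; rewrite -/Q in oQ.
have PU : P `<=` U by move=> y [c Ic [hc _]]; exists c.
have PQ0 : P `&` Q = set0 by apply/seteqP; split=> // y [Py [_]].
have PQU : P `|` Q = U.
  apply/seteqP; split=> [y [/PU|[]]//|y Uy].
  by case: (pselect (P y)) => Py; [left|right].
have clU : closure U = closure P `|` closure Q by rewrite -closureU PQU.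
have Pa : P a.
  exists ((c0 + S) / 2); have [ml mr] := midf_lt c0ltS.
    by rewrite /= (ltW ml).
  by split; [exact: le_lt_trans ml|].
have Qb : Q b.
  split; first by rewrite UE /=; exact: le_lt_trans c0ltS.
  by move=> [c /= /andP[cc cS] [_]]; apply; exact: sep_lt.
have nclPQ y : closure P y -> ~ Q y.
  move=> clPy Qy; have [z [Pz Qz]] := clPy _ (open_nbhs_nbhs (conj oQ Qy)).
  by have : set0 z by rewrite -PQ0.
apply: nsepS; exists (closure P `&` [set x | h x <= S]).
exists ([set x | h x <= S] `\` closure P); split.
- by apply: closedI => //; exact: closed_closure.
- move=> y cly; have hy : h y <= S.
    by apply: closed_le_h; apply: closureS cly => x [].
  split=> // clPy.
  move: hy; rewrite /= le_eqVlt => /orP[/eqP hy|hy]; last first.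
    have : U y by rewrite UE.
    rewrite -PQU => -[Py|/nclPQ]; last exact.
    have [z [[_ ncl] Pz]] := cly _ (open_nbhs_nbhs (conj oP Py)).
    by apply: ncl; exact: subset_closure.
  (* [W] meets [P], hence misses [Q]. A point [z] of the second part in [W] is then outside
     [closure U], so a local minimum at level [S]; this forbids points of [U] in [W], such as
     [p]. *)
  have [W [oW Wy WPQ Wiso]] := loc y.
  have nW := open_nbhs_nbhs (conj oW Wy).
  have [p [Pp Wp]] := clPy _ nW.
  have WQ0 : W `&` Q = set0.
    case: (WPQ P Q) => //; first by rewrite PQU UE hy.
    by move=> WP0; have : set0 p by rewrite -WP0.
  have [z [[hz nclz] Wz]] := cly _ nW.
  have nclQz : ~ closure Q z.
    move=> clQz; have [q [Qq Wq]] := clQz _ (open_nbhs_nbhs (conj oW Wz)).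
    by have : set0 q by rewrite -WQ0.
  have nclUz : ~ closure U z by rewrite clU => -[].
  have hzS : h z = S.
    apply/eqP; rewrite eq_le hz /= leNgt; apply/negP => hzS.
    by apply: nclUz; apply: subset_closure; rewrite UE.
  have : set0 p.
    rewrite -(Wiso z) //; rewrite ?hy -?UE //.
    by split=> //; exact: PU.
  by [].
- by apply/seteqP; split=> // y [[clP _] [_]].
- apply/seteqP; split=> y; last by case=> -[].
  by move=> hy; case: (pselect (closure P y)) => cl; [left|right].
- split; split => //=.
  + exact: subset_closure.
  + exact: le_trans c0S.
  + exact: le_trans c0S.
  + by move=> /nclPQ.
Qed.

End sublevel.

(** * Segments, cones and convex functions in a vector space *)

Section local_model.
Context {R : realType} {n : nat} {X : topologicalType}.
Notation V := 'rV[R]_n.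

Lemma segment_continuous (x y : V) :
  continuous (fun t : R => (1 - t) *: x + t *: y).
Proof.
move=> t; apply: (@continuousD _ _ _ (fun t : R => (1 - t) *: x) (fun t : R => t *: y)).
  apply: continuousZr_tmp; apply: continuousB; [exact: cvg_cst|exact: cvg_id].
by apply: continuousZr_tmp; exact: cvg_id.
Qed.

Lemma segment0 (x y : V) : (1 - 0) *: x + 0 *: y = x.
Proof. by rewrite subr0 scale1r scale0r addr0. Qed.

Lemma segment1 (x y : V) : (1 - 1) *: x + 1 *: y = y.
Proof. by rewrite subrr scale1r scale0r add0r. Qed.

Lemma segment_near (x y : V) (N : set V) : open N -> N x ->
  exists t, [/\ 0 < t, t <= 1 & N ((1 - t) *: x + t *: y)].
Proof.
move=> oN Nx.
have : nbhs (0 : R) [set t | N ((1 - t) *: x + t *: y)].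
  apply: (segment_continuous x y 0).
  by rewrite /= segment0; exact: open_nbhs_nbhs.
move=> /nbhs_ballP[e /= e0 eN]; exists (Num.min (e / 2) 1).
have t0 : 0 < Num.min (e / 2) 1 by rewrite lt_min ltr01 andbT divr_gt0.
split=> //; first by rewrite ge_min lexx orbT.
apply: eN; rewrite -ball_normE /= sub0r normrN gtr0_norm //.
by rewrite gt_min ltr_pdivrMr // ltr_pMr // ltr1n.
Qed.

(** A cone is determined by its germ at the vertex: contract [p] towards [v] into [N], then dilate
    back inside [C'] by the inverse factor. *)
Lemma cone_subset (C C' N : set V) (v : V) : cone_with_vertex C v ->
  cone_with_vertex C' v -> open N -> N v -> C `&` N `<=` C' -> C `<=` C'.
Proof.
move=> [_ coneC] [C'v coneC'] oN Nv sub p Cp.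
have [->//|/eqP pv] := eqVneq p v.
have [t [t0 t1 Nt]] := segment_near v p N oN Nv.
set q := (1 - t) *: v + t *: p in Nt.
have qvE : q - v = t *: (p - v).
  by rewrite /q scalerBl scale1r scalerBr addrAC addrAC addrC !addrA addNr add0r addrC.
have C'q : C' q by apply: sub; split=> //; apply: coneC => //; exact: ltW.
have -> : p = (1 - t^-1) *: v + t^-1 *: q.
  rewrite scalerBl scale1r -addrA -scalerN -scalerDr (addrC (- v)) qvE scalerA.
  by rewrite mulVf ?gt_eqF // scale1r addrC subrK.
apply: coneC' => //; first by rewrite invr_ge0 ltW.
move=> /eqP; rewrite -subr_eq0 qvE scaler_eq0 gt_eqF //= subr_eq0 => /eqP.
exact: pv.
Qed.

Lemma convex_connected (D : set V) : convex_subset D -> connected D.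
Proof.
move=> cD B [b Bb] [G oG BG] [F cF BF].
apply/seteqP; split=> [x|x Dx]; first by rewrite BG => -[].
pose s := (fun t : R => (1 - t) *: b + t *: x) @` `[0, 1].
have cs : connected s.
  apply: connected_continuous_connected; first exact: segment_connected.
  exact/continuous_subspaceT/segment_continuous.
have Db : D b by move: Bb; rewrite BG => -[].
have sD : s `<=` D.
  by move=> z [t /=]; rewrite in_itv /= => /andP[t0 t1] <-; exact: cD.
have sb : s b by exists 0; rewrite ?segment0 //= in_itv /= lexx ler01.
have sx : s x by exists 1; rewrite ?segment1 //= in_itv /= lexx ler01.
suff : s `<=` G by move=> /(_ _ sx) Gx; rewrite BG.
have DGF z : D z -> G z <-> F z.
  move=> Dz; split=> [Gz|Fz].
    have : B z by rewrite BG.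
    by rewrite BF => -[].
  have : B z by rewrite BF.
  by rewrite BG => -[].
apply: (@connected_sub_open _ _ _ (~` F)) => //; first exact: closed_openC.
- move=> z /sD /DGF e; case: (pselect (F z)) => Fz; [left|by right].
  exact/e.
- by apply/seteqP; split=> // z [[/sD /DGF e /e Fz]].
- by exists b; split=> //; move: Bb; rewrite BG => -[].
Qed.

Lemma convex_subsetI (A B : set V) :
  convex_subset A -> convex_subset B -> convex_subset (A `&` B).
Proof.
by move=> cA cB x y t t0 t1 [Ax Bx] [Ay By]; split; [exact: cA|exact: cB].
Qed.

Definition convex_fun (g : V -> R) : Prop := forall (x y : V) (t : R),
  0 <= t -> t <= 1 -> g ((1 - t) *: x + t *: y) <= (1 - t) * g x + t * g y.

Lemma convex_fun_sublevel (g : V -> R) (c : R) :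
  convex_fun g -> convex_subset [set x | g x < c].
Proof.
move=> cg x y t t0 t1 /= gx gy; apply: (le_lt_trans (cg _ _ _ t0 t1)).
(* Strictness comes from the weight [t] of [y], so [t = 0] is treated apart. *)
have [->|tn0] := eqVneq t 0; first by rewrite subr0 mul1r mul0r addr0.
have -> : c = (1 - t) * c + t * c by rewrite -mulrDl subrK mul1r.
apply: ler_ltD; first by rewrite ler_wpM2l ?subr_ge0 // ltW.
by rewrite ltr_pM2l // lt_neqAle eq_sym tn0.
Qed.

Lemma convex_funD (g1 g2 : V -> R) :
  convex_fun g1 -> convex_fun g2 -> convex_fun (fun w => g1 w + g2 w).
Proof.
move=> c1 c2 x y t t0 t1; rewrite !mulrDr addrACA.
by apply: lerD; [exact: c1|exact: c2].
Qed.

Lemma convex_fun_norm_affine (W : normedModType R) (L : V -> W) :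
  (forall x y t, L ((1 - t) *: x + t *: y) = (1 - t) *: L x + t *: L y) ->
  convex_fun (fun w => `|L w|).
Proof.
move=> affL x y t t0 t1; rewrite affL (le_trans (ler_normD _ _)) // !normrZ.
by rewrite !ger0_norm // subr_ge0.
Qed.

Lemma subr_affine (v x y : V) (t : R) :
  (1 - t) *: x + t *: y - v = (1 - t) *: (x - v) + t *: (y - v).
Proof. by rewrite !scalerBr addrACA -opprD -scalerDl subrK scale1r. Qed.

Lemma convex_fun_dist (v : V) : convex_fun (fun w => `|w - v|).
Proof. by apply: convex_fun_norm_affine => x y t; exact: subr_affine. Qed.

Lemma convex_ball (v : V) (r : R) : convex_subset (ball v r).
Proof.
have -> : ball v r = [set w | `|w - v| < r].
  by rewrite -ball_normE; apply/seteqP; split=> w /=; rewrite distrC.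
exact/convex_fun_sublevel/convex_fun_dist.
Qed.

(** * Local structure of [f] and of the sublevel sets of [g \o f] *)

Variable f : X -> V.

(** LFC passes to subsets and the convexity data hold on every small open set, so one neighborhood
    carries both. *)
Lemma local_model : local_convexity_data f -> locally_fiber_connected f ->
  forall x : X, exists (U : set X) (C : set V),
    [/\ open U, U x, LFC f U, convex_cone C (f x) &
    [/\ f @` U `<=` C, rel_nbhs C (f x) (f @` U) &
        forall W, open W -> W `<=` U -> rel_open C (f @` W)]].
Proof.
move=> lcd lfc x; have [N [Nx HN]] := lcd x.
have [U0 [U0x U0N lU0]] := lfc x N^° (@open_interior _ N) Nx.
have UN : U0^° `<=` N.
  by move=> z /interior_subset /U0N /interior_subset.
have [C [cC fUC nC oC _]] := HN U0^° (@open_interior _ U0) U0x UN.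
exists U0^°, C; split=> //; first exact: open_interior.
move=> a /interior_subset Ua y z /interior_subset Uy /interior_subset Uz.
exact: lU0.
Qed.

(* The first property says that [{g \o f < g (f y)}] behaves near [y] as if it
   were connected; the second, that a local minimum of [g \o f] at the level of
   [y] is a minimum on all of [W]. *)
Lemma sublevel_local (g : V -> R) : continuous f ->
  local_convexity_data f -> locally_fiber_connected f -> convex_fun g ->
  forall y, exists W : set X, [/\ open W, W y,
     forall P Q : set X, open P -> open Q -> P `&` Q = set0 ->
       P `|` Q = [set x | g (f x) < g (f y)] ->
       W `&` P = set0 \/ W `&` Q = set0 &
     forall z, W z -> g (f z) = g (f y) ->
       ~ closure [set x | g (f x) < g (f y)] z ->
       W `&` [set x | g (f x) < g (f y)] = set0].
Proof.
move=> cf lcd lfc cg y.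
have [U [C [oU Uy lU [[Cy _] cC] [fUC [N [oN Ny CN]] oC]]]] := local_model lcd lfc y.
have [r r0 rN] := (nbhs_ballP _ _).1 (open_nbhs_nbhs (conj oN Ny)).
(* The ball is convex and lies in [N], so its trace on [C] is convex and covered by the image of
   [U]. *)
pose W := U `&` f @^-1` (ball (f y) r).
have oW : open W.
  apply: openI => //; apply: open_comp => [x _|]; first exact: cf.
  exact: ball_open.
have WU : W `<=` U by move=> x [].
exists W; split=> //; first by split=> //=; exact: ballxx.
- move=> P Q oP oQ PQ0 PQ.
  have [G1 [oG1 E1]] := oC (W `&` P) (openI oW oP) (fun x xW => WU x xW.1).
  have [G2 [oG2 E2]] := oC (W `&` Q) (openI oW oQ) (fun x xW => WU x xW.1).
  pose D := C `&` ball (f y) r `&` [set w | g w < g (f y)].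
  have cD : connected D.
    apply: convex_connected; apply: convex_subsetI.
      by apply: convex_subsetI => //; exact: convex_ball.
    exact: convex_fun_sublevel.
  have fWD x : W x -> g (f x) < g (f y) -> D (f x).
    by move=> [Ux Bx] gx; split=> //; split=> //; apply: fUC; exists x.
  have D12 : D `<=` G1 `|` G2.
    move=> w [[Cw Bw] gw]; have [x Ux xw] := CN w (conj Cw (rN _ Bw)).
    have : (P `|` Q) x by rewrite PQ /= xw.
    have Wx : W x by split=> //=; rewrite xw.
    case=> [Px|Qx]; [left|right].
      have : (f @` (W `&` P)) w by exists x.
      by rewrite E1 => -[].
    have : (f @` (W `&` Q)) w by exists x.
    by rewrite E2 => -[].
  (* A common value [w] has preimages [x1] in [P] and [x2] in [Q], which LFC puts in one component
     of the fiber. As [g \o f] is constant on the fiber, this component lies in the union of [P] and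
     [Q], hence in [P] alone. *)
  have D0 : D `&` G1 `&` G2 = set0.
    apply/seteqP; split=> // w [[[[Cw Bw] gw] G1w] G2w].
    have [x1 [W1 P1] xw1] : (f @` (W `&` P)) w by rewrite E1.
    have [x2 [W2 Q2] xw2] : (f @` (W `&` Q)) w by rewrite E2.
    have e21 : f x2 = f x1 by rewrite xw1.
    have := lU x1 (WU _ W1) x1 x2 (WU _ W1) (WU _ W2) erefl e21.
    set K := connected_component _ x1 => KE.
    have Kf : K `<=` f @^-1` [set f x1] by move=> z [B [_ BA _]] /BA.
    have K1 : K x1.
      by exists [set x1] => //; split=> //; [move=> z ->|exact: connected1].
    have K2 : K x2.
      by rewrite KE; exists [set x2] => //; split=> //; [move=> z ->|exact: connected1].
    have cK : connected K by exact: component_connected.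
    have : K `<=` P.
      apply: (@connected_sub_open _ _ _ Q) => //; last by exists x1.
        by move=> z /Kf fz; rewrite PQ; move: fz => /= ->; rewrite xw1.
      by rewrite -setIA PQ0 setI0.
    by move=> /(_ _ K2) P2; have : (P `&` Q) x2 by []; rewrite PQ0.
  case: (pselect (W `&` P = set0)) => [|/eqP/set0P[p [Wp Pp]]]; [by left|right].
  apply/seteqP; split=> // q [Wq Qq].
  have gp : g (f p) < g (f y) by have : (P `|` Q) p := or_introl Pp; rewrite PQ.
  have gq : g (f q) < g (f y) by have : (P `|` Q) q := or_intror Qq; rewrite PQ.
  have G1p : G1 (f p).
    have : (f @` (W `&` P)) (f p) by exists p.
    by rewrite E1 => -[].
  have G2q : G2 (f q).
    have : (f @` (W `&` Q)) (f q) by exists q.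
    by rewrite E2 => -[].
  have DG1 : D `<=` G1.
    apply: connected_sub_open D0 _ => //.
    by exists (f p); split=> //; exact: fWD.
  have Dq := fWD q Wq gq.
  suff : (D `&` G1 `&` G2) (f q) by rewrite D0.
  by split=> //; split=> //; exact: DG1.
(* Moving slightly from [f z] towards [f p] stays in the image of [G], by openness into [C], while
   convexity of [g] makes the level drop strictly. *)
- move=> z Wz gz ncl; apply/seteqP; split=> // p [Wp gp].
  pose G := ~` closure [set x | g (f x) < g (f y)].
  have oG : open G by apply: closed_openC; exact: closed_closure.
  have [G1 [oG1 E1]] := oC (W `&` G) (openI oW oG) (fun x xW => WU x xW.1).
  have G1z : G1 (f z).
    have : (f @` (W `&` G)) (f z) by exists z.
    by rewrite E1 => -[].
  have [t [t0 t1 G1t]] := segment_near (f z) (f p) _ oG1 G1z.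
  have [x [Wx Gx] xE] : (f @` (W `&` G)) ((1 - t) *: f z + t *: f p).
    rewrite E1; split.
      by apply: cC => //; [exact: ltW|apply: fUC; exists z => //; exact: WU|apply: fUC; exists p => //; exact: WU].
    by [].
  apply: Gx; apply: subset_closure => /=; rewrite xE.
  apply: (le_lt_trans (cg _ _ _ (ltW t0) t1)); rewrite gz.
  have {2}-> : g (f y) = (1 - t) * g (f y) + t * g (f y) by rewrite -mulrDl subrK mul1r.
  by rewrite ltrD2l ltr_pM2l.
Qed.

(** * Neighborhoods of preimages under a closed map *)

Lemma closed_map_tube (K : set V) (G : set X) : closed_map f ->
  open G -> f @^-1` K `<=` G ->
  exists N : set V, [/\ open N, K `<=` N & f @^-1` N `<=` G].
Proof.
move=> clf oG KG; exists (~` (f @` ~` G)); split.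
- by apply: closed_openC; apply: clf; exact: open_closedC.
- by move=> v Kv [x nGx fx]; apply: nGx; apply: KG; rewrite /= fx.
- by move=> x /= nfx; apply: contrapT => nGx; apply: nfx; exists x.
Qed.

(** Outside [N] and up to level [c + 1], compactness gives [g] a minimum unless nothing is left
    there; it exceeds [c], and half the gap is the margin. *)
Lemma sublevel_near (g : V -> R) (c : R) (G : set X) : closed_map f ->
  continuous g -> (forall c, bounded_set [set w | g w <= c]) ->
  open G -> [set x | g (f x) <= c] `<=` G ->
  exists2 e, 0 < e & [set x | g (f x) <= c + e] `<=` G.
Proof.
move=> clf cg bg oG sub.
have [N [oN KN NG]] := closed_map_tube [set w | g w <= c] _ clf oG sub.
pose K := [set w | g w <= c + 1] `&` ~` N.
have clK : closed [set w | g w <= c + 1].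
  exact: (closed_comp (fun x _ => cg x) (@closed_le _ _)).
have cK : compact K.
  apply: bounded_closed_compact; last by apply: closedI => //; exact: open_closedC.
  have [M [Mr HM]] := bg (c + 1).
  by exists M; split=> // m Mm w [/(HM _ Mm)].
have [K0|/set0P K0] := eqVneq K set0.
  exists 1 => // x gx; apply: NG; apply: contrapT => nN.
  by have : K (f x) by []; rewrite K0.
have [w /set_mem[gw nNw] wmin] :=
  compact_EVT_min K0 cK (continuous_subspaceT cg).
have cw : c < g w by rewrite ltNge; apply/negP => /KN.
exists ((g w - c) / 2); first by rewrite divr_gt0 // subr_gt0.
move=> x /= gx; apply: NG; apply: contrapT => nN.
have mw : c + (g w - c) / 2 < g w by lra.
have : g w <= g (f x).
  apply: wmin; apply/mem_set; split=> //=.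
  by apply: (le_trans gx); rewrite /= in gw; lra.
by rewrite leNgt (le_lt_trans gx mw).
Qed.

(** * Global consequences: connected fibers, openness, convexity of the image *)

Hypotheses (cX : connected [set: X]) (lX : locally_connected X)
  (nX : normal_space X) (cf : continuous f) (clf : closed_map f)
  (lcd : local_convexity_data f) (lfc : locally_fiber_connected f).

Lemma convex_sublevel_connected (g : V -> R) : continuous g -> convex_fun g ->
  (forall c, bounded_set [set w | g w <= c]) ->
  forall c, connected [set x | g (f x) <= c].
Proof.
move=> cg cvg bg; apply: (@sublevel_connected _ _ (g \o f)) => //.
- by move=> x; apply: continuous_comp; [exact: cf|exact: cg].
- by move=> c G; exact: sublevel_near.
- exact: sublevel_local.
Qed.

Lemma subr_continuous (W : normedModType R) (L : V -> W) (v : W) :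
  continuous L -> continuous (fun w => L w - v).
Proof.
move=> cL w; apply: (@continuousB _ _ _ L (cst v)); first exact: cL.
exact: cst_continuous.
Qed.

Lemma norm_continuous_comp (W : normedModType R) (L : V -> W) :
  continuous L -> continuous (fun w => `|L w|).
Proof.
move=> cL w; apply: continuous_comp; [exact: cL|exact: norm_continuous].
Qed.

Lemma fiber_connected (v : V) : connected (f @^-1` [set v]).
Proof.
have -> : f @^-1` [set v] = [set x | `|f x - v| <= 0].
  by apply/seteqP; split=> x /=; rewrite normr_le0 subr_eq0 => /eqP.
apply: (@convex_sublevel_connected (fun w : V => `|w - v| : R)).
- by apply: norm_continuous_comp; apply: (subr_continuous _ id v) => w; exact: cvg_id.
- exact: convex_fun_dist.
- move=> c; exists (c + `|v|); split; first exact: num_real.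
  move=> M cM w /= wc; rewrite (le_trans _ (ltW cM)) //.
  by rewrite -[w in `|w|](subrK v) (le_trans (ler_normD _ _)) // lerD2r.
Qed.

Lemma open_onto_image_of_fiber_connected : open_onto_image f.
Proof.
move=> W oW.
pose T := [set G : set V | open G /\ range f `&` G `<=` f @` W].
exists (\bigcup_(G in T) G); split.
  by apply: bigcup_open => G [].
apply/seteqP; split=> [v|v [fv [G [_ sub] Gv]]]; last exact: sub.
move=> [x Wx <-]; split; first by exists x.
have [U [C [oU Ux _ [coneC _] [fUC _ oC]]]] := local_model lcd lfc x.
pose F := f @^-1` [set f x].
(* [A] is the largest open set mapped into the cone at [x]. Once it contains the whole fiber,
   closedness of [f] gives a neighborhood of [f x] with preimage in [A]. *)
pose A := \bigcup_(G in [set G : set X | open G /\ f @` G `<=` C]) G.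
have oA : open A by apply: bigcup_open => G [].
have fAC y : A y -> C (f y).
  by move=> [G [_ GC] Gy]; apply: GC; exists y.
have Ax : A x by exists U.
have FA : F `<=` A.
  (* On the fiber, [B] is to be the complement of [A]: a point is in [A] as soon as its [U'] meets
     [A] within the fiber. *)
  pose B := \bigcup_(G in [set G : set X | open G /\ G `&` A `&` F = set0]) G.
  apply: (@connected_sub_open _ _ _ B) => //.
  - exact: fiber_connected.
  - by apply: bigcup_open => G [].
  - move=> y Fy; have fyx : f y = f x by [].
    have [U' [C' [oU' U'y _ [coneC' _] [fUC' _ oC']]]] := local_model lcd lfc y.
    case: (pselect (U' `&` A `&` F = set0)) => [e|/eqP/set0P[z [[U'z Az] Fz]]].
      by right; exists U'.
    left; exists U' => //; split=> // w /fUC'.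
    have fzx : f z = f x by [].
    (* The image of this intersection is open in [C'] and lies in [C], so [C'] is inside [C] near
       the common vertex [f x], hence everywhere. *)
    have [N [oN EN]] := oC' (U' `&` A) (openI oU' oA) (fun x xA => xA.1).
    have Nz : N (f x).
      rewrite -fzx.
      have : (f @` (U' `&` A)) (f z) by exists z.
      by rewrite EN => -[].
    rewrite fyx in coneC'.
    apply: (cone_subset _ _ _ _ coneC' coneC oN Nz).
    by rewrite -EN => _ [y' [_ Ay'] <-]; exact: fAC.
  - apply/seteqP; split=> // y [[Fy Ay] [G [_ G0] Gy]].
    by have : (G `&` A `&` F) y by []; rewrite G0.
  - by exists x.
have [N [oN xN NA]] := closed_map_tube [set f x] _ clf oA FA.
(* Values near [f x] are taken only in [A], hence lie in [C], where this image is open. *)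
have [N' [oN' E']] := oC (W `&` U) (openI oW oU) (fun x xA => xA.2).
exists (N `&` N'); last first.
  split; first exact: xN.
  have : (f @` (W `&` U)) (f x) by exists x.
  by rewrite E' => -[].
split; first exact: openI.
move=> _ [[y _ <-] [Ny N'y]].
have : (f @` (W `&` U)) (f y) by rewrite E'; split=> //; apply: fAC; exact: NA.
by move=> [z [Wz _] zy]; exists z.
Qed.

Lemma range_convex : convex_subset (range f).
Proof.
move=> x y t t0 t1 fx fy.
have [<-|xy] := eqVneq x y; first by rewrite -scalerDl subrK scale1r.
(* A coordinate separating [x] from [y] yields an affine parameter [s], 0 at [x] and 1 at [y]; [L]
   will be the deviation from the line through them. *)
have [j xyj] : exists j, y ord0 j - x ord0 j != 0.
  apply: contrapT => H; move/eqP: xy; apply; apply/rowP => j.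
  apply/eqP; rewrite eq_sym -subr_eq0; apply: contrapT => /negP yx; apply: H.
  by exists j.
pose d := y ord0 j - x ord0 j.
pose s (w : V) : R^o := (w ord0 j - x ord0 j) / d.
have sx : s x = 0 by rewrite /s subrr mul0r.
have sy : s y = 1 by rewrite /s divff.
have s_aff a b u : s ((1 - u) *: a + u *: b) = (1 - u) * s a + u * s b.
  by rewrite /s !mxE; field.
have cs : continuous s.
  move=> w.
  apply: (@continuousM R _ (fun w : V => w ord0 j - x ord0 j) (cst d^-1)).
    apply: (subr_continuous R^o (fun w : V => w ord0 j) (x ord0 j)) => z.
    exact: coord_continuous.
  exact: cst_continuous.
pose L (w : V) : V := w - x - s w *: (y - x).
have L_aff a b u : L ((1 - u) *: a + u *: b) = (1 - u) *: L a + u *: L b.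
  rewrite /L subr_affine s_aff.
  move: (a - x) (b - x) (y - x) (s a) (s b) => p q v sa sb.
  by rewrite (scalerDl v) !scalerBr !scalerA opprD addrACA.
have cL : continuous L.
  move=> w; apply: (@continuousB _ _ _ (fun w : V => w - x) (fun w => s w *: (y - x))).
    by apply: (subr_continuous _ id x) => z; exact: cvg_id.
  by apply: continuousZr_tmp; exact: cs.
have s1_aff a b u :
    s ((1 - u) *: a + u *: b) - 1 = (1 - u) * (s a - 1) + u * (s b - 1).
  by rewrite s_aff; ring.
(* [g >= 1] everywhere, with equality exactly on the segment from [x] to [y]. *)
pose g (w : V) : R := `|L w| + (`|s w| + `|s w - 1|).
have cg : continuous g.
  have cs1 : continuous (fun w => s w - 1) by exact: subr_continuous.
  move=> w; apply: (@continuousD _ R^o _ (fun w => `|L w|)); last first.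
    apply: (@continuousD _ R^o _ (fun w => `|s w|) (fun w => `|s w - 1|)).
      exact: (norm_continuous_comp R^o).
    exact: (norm_continuous_comp R^o).
  exact: norm_continuous_comp.
have cvxg : convex_fun g.
  apply: convex_funD; first exact: convex_fun_norm_affine.
  apply: convex_funD; first exact: (@convex_fun_norm_affine R^o).
  exact: (@convex_fun_norm_affine R^o).
have bg c : bounded_set [set w | g w <= c].
  exists (c + `|x| + c * `|y - x|); split; first exact: num_real.
  move=> M cM w /= gw; rewrite (le_trans _ (ltW cM)) //.
  have Lc : `|L w| <= c by rewrite (le_trans _ gw) // lerDl addr_ge0.
  have sc : `|s w| <= c.
    by rewrite (le_trans _ gw) // /g addrCA lerDl addr_ge0.
  have -> : w = L w + x + s w *: (y - x).
    by rewrite /L addrAC subrK subrK.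
  rewrite (le_trans (ler_normD _ _)) // lerD //.
    by rewrite (le_trans (ler_normD _ _)) // lerD2r.
  by rewrite normrZ ler_wpM2r.
(* Level 1 gives the preimage of the segment; [s \o f] sends this connected set onto an interval
   containing 0 and 1, hence [t]. *)
have cK := convex_sublevel_connected _ cg cvxg bg 1.
set K := [set _ | _] in cK.
have csf : connected ((s \o f) @` K).
  apply: connected_continuous_connected => //; apply: continuous_subspaceT => z.
  by apply: continuous_comp; [exact: cf|exact: cs].
have itv := (connected_intervalP _).1 csf.
have [a _ ax] := fx; have [b _ by_] := fy.
have s0K : ((s \o f) @` K) 0.
  exists a; last by rewrite /= ax.
  by rewrite /K /= ax /g /L sx scale0r !subrr sub0r normrN normr1 2!normr0 !add0r.
have s1K : ((s \o f) @` K) 1.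
  exists b; last by rewrite /= by_.
  by rewrite /K /= by_ /g /L sy scale1r !subrr 2!normr0 normr1 addr0 add0r.
have [z gz sz] : ((s \o f) @` K) t.
  by apply: (itv _ _ s0K s1K); rewrite t0 t1.
exists z => //; rewrite /= in sz.
(* For [t] in [[0, 1]] the two terms in [s] already sum to 1, leaving 0 for the norm of [L]. *)
have L0 : L (f z) = 0.
  apply/eqP; rewrite -normr_le0; move: gz; rewrite /K /= /g sz.
  rewrite (ger0_norm t0) ler0_norm ?subr_le0 // opprB addrC subrKC => gz.
  by lra.
have -> : f z = L (f z) + x + s (f z) *: (y - x).
  by rewrite /L addrAC subrK subrK.
by rewrite L0 add0r sz scalerBr scalerBl scale1r addrAC -addrA (addrC (t *: y)) addrA.
Qed.

End local_model.

Theorem theorem2p27 (R : realType) (n : nat) (X : topologicalType)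
  (f : X -> 'rV[R]_n) :
  connected [set: X] -> locally_connected X -> hausdorff_space X ->
  first_countable X -> normal_space X ->
  continuous f -> closed_map f ->
  local_convexity_data f -> locally_fiber_connected f ->
  [/\ (forall v : 'rV[R]_n, connected (f @^-1` [set v])),
      open_onto_image f &
      closed (range f) /\ convex_subset (range f)].
Proof.
move=> cX lX _ _ nX cf clf lcd lfc; split; last split.
- exact: fiber_connected.
- exact: open_onto_image_of_fiber_connected.
- by apply: clf; exact: closedT.
- exact: range_convex.
Qed.
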